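(* Let $I$ be a separable metrisable space, $E$ a Hausdorff space, $\mu$ an inner regular Borel measure on $I$ with full support, that is, $\mathrm{supp}\,\mu=I$, and let $\varphi:I\times I\to\mathbb{R}$ be such that $\varphi(\cdot,t)$ is continuous for any $t\in I$. Then any two $E$-valued processes $X$ and $\tilde X$ that are weak modifications of each other relative to $\mu$ are indistinguishable if the following two conditions hold: (i) The paths of $X$ and $\tilde X$ are sequentially continuous with respect to $\varphi$. (ii) There is a countable set $J_\varphi$ in $I_\varphi^c$ such that $X_t=\tilde X_t$ a.s. for all $t\in J_\varphi$ and the paths of $X$ and $\tilde X$ are sequentially continuous on $I_\varphi^c\setminus J_\varphi$.
   Context: $(\Omega,\mathcal{F},\mathbb{P})$ is a probability space (not necessarily complete). An $E$-valued process is a map $X:I\times\Omega\to E$, $(t,\omega)\mapsto X_t(\omega)$ such that $X_t$ is Borel measurable for any $t\in I$. $\tilde X$ is a weak modification of $X$ with respect to $\mu$ if $X_t=\tilde X_t$ a.s. for $\mu$-a.e. $t\in I$. The support $\mathrm{supp}\,\mu$ of the inner regular measure $\mu$ is the smallest closed set in $I$ of full $\mu$-measure. Fix a metric inducing the topology of $I$ and let $B_\delta(t)$ be the open ball of radius $\delta$ around $t$. A map $x:I\to E$ is sequentially continuous with respect to $\varphi$ if any sequence $(t_n)_{n\in\mathbb{N}}$ in $I$ that converges to some $t\in I$ satisfies $\lim_{n\uparrow\infty}x(t_n)=x(t)$ as soon as $\varphi(t_n,t)>0$ for all $n\in\mathbb{N}$. The set $I_\varphi$ is defined by $I_\varphi:=\{t\in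 I\,|\,\forall\delta>0\ \exists s\in B_\delta(t):\varphi(s,t)>0\}$ and $I_\varphi^c:=I\setminus I_\varphi$. Sequential continuity of a path $x$ on a subset means that $\lim_{n\uparrow\infty} x(t_n)=x(t)$ for each $t$ in that subset and any sequence $(t_n)_{n\in\mathbb{N}}$ in $I$ converging to $t$. *)

(* Defs.v *)
From HB Require Import structures.
From mathcomp Require Import all_boot all_order all_algebra.
From mathcomp Require Import all_classical all_reals all_analysis.
Import Order.TTheory GRing.Theory Num.Theory.
Import numFieldNormedType.Exports.

Set Implicit Arguments.
Unset Strict Implicit.
Unset Printing Implicit Defensive.

Local Open Scope classical_set_scope.
Local Open Scope ring_scope.

(* The library's measurable spaces are pointed, so a metric space carrying a
   measure on its Borel sigma-algebra has to be pointed as well. *)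
#[short(type="pmetricType")]
HB.structure Definition PointedMetric (K : numDomainType) :=
  { M of Metric K M & Pointed M }.

Notation borel T := (g_sigma_algebraType (@open T)).

Definition separable (T : topologicalType) : Prop :=
  exists2 D : set T, countable D & dense D.

Section borel_measures.
Context {R : realType} {T : ptopologicalType}.
Variable mu : {measure set (borel T) -> \bar R}.

Definition inner_regular : Prop :=
  forall B : set (borel T), measurable B ->
    mu B = ereal_sup [set mu K | K in [set K : set T | compact K /\ K `<=` B]].

Definition full_measure (C : set T) : Prop := mu (~` C) = 0%E.

Definition is_support (S : set T) : Prop :=
  [/\ closed S, full_measure S &
      forall C : set T, closed C -> full_measure C -> S `<=` C].

End borel_measures.

Section processes.
Context {R : realType} {d : measure_display} {Omega : measurableType d}.
Variable P : probability Omega R.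
Context {I E : ptopologicalType}.
Implicit Types X : I -> Omega -> E.

Definition process X : Prop :=
  forall t, measurable_fun setT (X t : Omega -> borel E).

(* [{ae P, _}] only asks that the exceptional set be contained in a measurable
   null set; {w | X t w = X' t w} need not be measurable for Hausdorff E. *)
Definition as_eq_at X X' (t : I) : Prop :=
  {ae P, forall w, X t w = X' t w}.

Definition weak_modification (mu : {measure set (borel I) -> \bar R}) X X' :
    Prop :=
  {ae mu, forall t, as_eq_at X X' t}.

Definition indistinguishable X X' : Prop :=
  {ae P, forall w, forall t, X t w = X' t w}.

End processes.

Section sequential_continuity.
Context {R : realType} {I : pmetricType R} {E : topologicalType}.
Variable phi : I -> I -> R.

Definition seq_continuous_wrt (x : I -> E) : Prop :=
  forall (u : nat -> I) (t : I), u @ \oo --> t ->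
    (forall n, 0 < phi (u n) t) -> x (u n) @[n --> \oo] --> x t.

Definition seq_continuous_on (A : set I) (x : I -> E) : Prop :=
  forall t, A t -> forall u : nat -> I, u @ \oo --> t ->
    x (u n) @[n --> \oo] --> x t.

Definition I_phi : set I :=
  [set t | forall delta : R, 0 < delta ->
             exists2 s, ball t delta s & 0 < phi s t].

End sequential_continuity.

(* Main.v *)
(** Since mu has full support, the set of times t at which X_t = X'_t almost
    surely is dense, and a separable metric space lets us extract from it a
    countable set D that is still dense. Almost surely, the two paths agree on
    D and on J. If t lies in I_phi, then the open sets {s | phi(s, t) > 0}
    accumulate at t and hence meet D arbitrarily close to t, so t is the limit
    of a sequence in D with phi(t_n, t) > 0; if t lies neither in I_phi nor
    in J, any sequence in D tending to t will do. In both cases the two paths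
    converge along the sequence, and their limits agree as E is Hausdorff. *)
Require Import Defs.
From mathcomp Require Import all_boot all_order all_algebra.
From mathcomp Require Import all_classical all_reals all_analysis.
Import Order.TTheory GRing.Theory Num.Theory.
Import numFieldNormedType.Exports.

Set Implicit Arguments.
Unset Strict Implicit.

Local Open Scope classical_set_scope.
Local Open Scope ring_scope.

(** An injection [f] of [A] into the naturals turns the family into a sequence, for which null sets
    add up; indices [n] outside the image of [f] impose no condition. *)
Lemma ae_countable (R : realType) (d : measure_display)
    (T : measurableType d) (mu : {measure set T -> \bar R}) (S : Type)
    (A : set S) (Q : S -> T -> Prop) :
  countable A -> (forall s, A s -> {ae mu, forall w, Q s w}) ->
  {ae mu, forall w, forall s, A s -> Q s w}.
Proof.
move=> /countable_injP[f f_inj] AQ.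
have : {ae mu, forall w, forall n : nat, forall s, A s -> f s = n -> Q s w}.
  apply: ae_foralln => n.
  have [[s As fs]|noA] := pselect (exists2 s, A s & f s = n).
    apply: filterS (AQ _ As) => w Qsw s' As' fs'.
    by rewrite (f_inj s' s) ?inE// fs fs'.
  by apply: aeW => w s As fs; exfalso; apply: noA; exists s.
by apply: filterS => w Qw s As; exact: Qw.
Qed.

Lemma ae_dense (R : realType) (T : ptopologicalType)
    (mu : {measure set (borel T) -> \bar R}) (Q : T -> Prop) :
  is_support mu [set: T] -> {ae mu, forall t, Q t} -> dense [set t | Q t].
Proof.
move=> [_ _ supp_min] aeQ U [t Ut] oU; apply: contrapT => UQ0.
have mU : measurable (U : set (borel T)) by exact: sub_sigma_algebra.
(* [U] misses [Q], so it lies in a negligible set; being Borel, it is null. Its complement is then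
   closed of full measure, hence everything by minimality of the support. *)
have muU : mu U = 0%E.
  apply: measure_negligible => //; apply: negligibleS aeQ => s Us Qs.
  by apply: UQ0; exists s.
have full : full_measure mu (~` U) by rewrite /full_measure setCK.
exact: (supp_min _ (open_closedC oU) full t I) Ut.
Qed.

Lemma dense_ballP (R : numFieldType) (T : pseudoMetricType R) (D : set T) :
  dense D <-> forall (t : T) (e : R), 0 < e -> exists2 s, D s & ball t e s.
Proof.
split=> [dD t e e0|dD U [t Ut] oU].
  (* Balls of a pseudometric structure need not be open, hence the interior. *)
  have [|s [/interior_subset ts Ds]] := dD (ball t e)^° _ (open_interior _).
    by exists t; exact: nbhsx_ballx.
  by exists s.
have /nbhs_ballP[e /= e0 teU] : nbhs t U by exact: open_nbhs_nbhs.
by have [s Ds /teU Us] := dD t e e0; exists s.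
Qed.

(** For each [c] in the countable dense set [C] and each [n], choose a point of [A] within 1/(n+1)
    of [c]. These points are dense: take [c] within [e / 2] of the target and [n] large. *)
Lemma dense_countable_subset (R : realType) (T : pseudoMetricType R)
    (A : set T) :
  separable T -> dense A -> exists D, [/\ countable D, D `<=` A & dense D].
Proof.
move=> [C cC /dense_ballP dC] /dense_ballP dA.
have near_A (p : T * nat) : exists s, A s /\ ball p.1 p.2.+1%:R^-1 s.
  by have [|s As ps] := dA p.1 p.2.+1%:R^-1 _; [rewrite invr_gt0|exists s].
have [f fP] := choice near_A.
exists (f @` (C `*` setT)); split.
- by apply: sub_countable (card_image_le _ _) _; exact: countableX.
- by move=> _ [p _ <-]; exact: (fP p).1.
apply/dense_ballP => t e e0.
have e20 : 0 < e / 2 by rewrite divr_gt0.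
have [n ne] : exists n : nat, n.+1%:R^-1 < e / 2.
  by have [n _ /(_ n (leqnn n))] := near_infty_natSinv_lt (PosNum e20); exists n.
have [c Cc tc] := dC t (e / 2) e20.
exists (f (c, n)); first by exists (c, n).
apply: (ball_split tc); apply: le_ball (ltW ne) _ _.
exact: (fP (c, n)).2.
Qed.

Lemma cvg_seq_near (R : realType) (T : pseudoMetricType R) (A : set T)
    (t : T) :
  (forall e : R, 0 < e -> exists2 s, A s & ball t e s) ->
  exists2 u : nat -> T, (forall n, A (u n)) & u @ \oo --> t.
Proof.
move=> At.
have near_t (n : nat) : exists s, A s /\ ball t n.+1%:R^-1 s.
  by have [|s As ts] := At n.+1%:R^-1 _; [rewrite invr_gt0|exists s].
have [u uP] := choice near_t.
exists u; first by move=> n; exact: (uP n).1.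
apply/cvg_ballP => e e0.
apply: filterS (near_infty_natSinv_lt (PosNum e0)) => n /ltW ne.
exact: le_ball ne _ (uP n).2.
Qed.

Lemma cvg_eq_along (E : topologicalType) (T : Type) (x y : T -> E)
    (u : nat -> T) (t : T) :
  hausdorff_space E -> (forall n, x (u n) = y (u n)) ->
  x (u n) @[n --> \oo] --> x t -> y (u n) @[n --> \oo] --> y t -> x t = y t.
Proof.
move=> hE xy xt yt; apply: (cvg_unique hE xt).
by rewrite (_ : (fun n => x (u n)) = (fun n => y (u n))) //; apply/funext.
Qed.

(** Positivity of [phi] at one point [s] near [t] persists on a neighbourhood of [s] by continuity,
    and [D] meets that neighbourhood. *)
Lemma I_phi_approach (R : realType) (I : pmetricType R) (phi : I -> I -> R)
    (D : set I) (t : I) :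
  continuous (fun s => phi s t) -> dense D -> I_phi phi t ->
  forall e : R, 0 < e -> exists2 s, D s /\ 0 < phi s t & ball t e s.
Proof.
move=> phi_cont dD It e e0.
have e20 : 0 < e / 2 by rewrite divr_gt0.
have [s ts phis] := It _ e20.
have oU : open ((ball s (e / 2))^° `&` [set r | 0 < phi r t]).
  apply: openI; first exact: open_interior.
  exact: (open_comp (fun x _ => phi_cont x) (@open_gt R 0)).
have [|r [[/interior_subset sr phir] Dr]] := dD _ _ oU.
  by exists s; split => //; exact: nbhsx_ballx.
by exists r => //; exact: ball_split ts sr.
Qed.

Theorem proposition3p6 (R : realType)
    (d : measure_display) (Omega : measurableType d) (P : probability Omega R)
    (I : pmetricType R) (I_sep : separable I)
    (E : ptopologicalType) (E_hausdorff : hausdorff_space E)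
    (mu : {measure set (borel I) -> \bar R})
    (mu_inner : inner_regular mu) (mu_supp : is_support mu [set: I])
    (phi : I -> I -> R) (phi_cont : forall t, continuous (fun s => phi s t))
    (X X' : I -> Omega -> E) (X_process : process X) (X'_process : process X')
    (XX'_mod : weak_modification P mu X X')
    (cond_i : forall w, seq_continuous_wrt phi (fun t => X t w) /\
                        seq_continuous_wrt phi (fun t => X' t w))
    (cond_ii : exists J : set I,
       [/\ countable J,
           J `<=` ~` I_phi phi,
           forall t, J t -> as_eq_at P X X' t &
           forall w, seq_continuous_on (~` I_phi phi `\` J) (fun t => X t w) /\
                     seq_continuous_on (~` I_phi phi `\` J) (fun t => X' t w)]) :
  indistinguishable P X X'.
Proof.
have [J [cJ JI XJ cont_J]] := cond_ii.
have [D [cD DX dD]] := dense_countable_subset I_sep (ae_dense mu_supp XX'_mod).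
have aeD := ae_countable cD DX.
have aeJ := ae_countable cJ XJ.
(* The exceptional null set depends only on [D] and [J]; from here [w] is fixed and [t] is
   arbitrary. *)
apply: filterS2 aeD aeJ => w XD XJw t.
have [It|nIt] := pselect (I_phi phi t).
  have [u uD ut] := cvg_seq_near (I_phi_approach (phi_cont t) dD It).
  have [cX cX'] := cond_i w.
  apply: (cvg_eq_along (x := X ^~ w) (y := X' ^~ w) E_hausdorff (u := u)).
  - by move=> n; exact: XD (uD n).1.
  - by apply: cX => // n; exact: (uD n).2.
  - by apply: cX' => // n; exact: (uD n).2.
have [Jt|nJt] := pselect (J t); first exact: XJw.
(* Continuity at [t] now holds along every sequence, so the density of [D] suffices, with no sign
   condition on [phi]. *)
have [u uD ut] := cvg_seq_near ((dense_ballP _).1 dD t).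
have [cX cX'] := cont_J w.
apply: (cvg_eq_along (x := X ^~ w) (y := X' ^~ w) E_hausdorff (u := u)).
- by move=> n; exact: XD (uD n).
- exact: cX.
- exact: cX'.
Qed.
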